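(* Let $z_*=x_*+iy_*\in\mathbb{C}$ with $x_*,y_*\in\mathbb{R}$, let $R>0$, and let $S(z_*,R)$ be the circle centered at $z_*$ with radius $R$. (1) If $0\notin S(z_*,R)$, then $\iota(S(z_*,R))$ is the circle consisting of all $x+iy$ ($x,y\in\mathbb{R}$) satisfying $$\left(x - \frac{-x_*}{R^2 - (x_*^2 + y_*^2)}\right)^2 + \left(y - \frac{y_*}{R^2 - (x_*^2 + y_*^2)}\right)^2 = \left(\frac{R}{R^2-(x_*^2+y_*^2)}\right)^2.$$ (2) If $0\in S(z_*,R)$, then $\iota(S(z_*,R))$ is the line (including the point $\infty$) described by the equation $x_*x-y_*y=\frac12$, i.e. $$\iota(S(z_*,R))=\left\{x+iy : x,y\in\mathbb{R},\ x_*x-y_*y=\tfrac12\right\}\cup\{\infty\}.$$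
   Context: $\overline{\mathbb{C}}=\mathbb{C}\cup\{\infty\}$ is the Riemann sphere and $\iota:\overline{\mathbb{C}}\to\overline{\mathbb{C}}$ is the inversion $\iota(z)=z^{-1}$ with $\iota(0)=\infty$ and $\iota(\infty)=0$. $S(z_*,R)=\{z\in\mathbb{C}: |z-z_*|=R\}$. *)

(* Defs.v *)
From mathcomp Require Import all_boot all_order all_algebra.
From mathcomp Require Import complex.
From mathcomp Require Import boolp classical_sets reals topology.
Set Implicit Arguments.
Unset Strict Implicit.
Unset Printing Implicit Defensive.
Import Order.TTheory GRing.Theory Num.Theory.
Local Open Scope classical_set_scope.
Local Open Scope ring_scope.
Local Open Scope complex_scope.

Section Defs.
Variable R : realType.

(* The finite point z is [Some z]. *)
Definition riemann_sphere : Type := one_point_compactification R[i].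

Definition infinity : riemann_sphere := None.

Definition finite_points (A : set R[i]) : set riemann_sphere := Some @` A.

Definition inversion (p : riemann_sphere) : riemann_sphere :=
  if p is Some z then (if z == 0 then infinity else Some z^-1) else Some 0.

(* The norm of R[i] takes its values in R[i], hence the cast of the radius. *)
Definition circle (c : R[i]) (r : R) : set R[i] :=
  [set z | `|z - c| = r%:C].

Definition is_circle (A : set R[i]) : Prop :=
  exists (c : R[i]) (r : R), 0 < r /\ A = circle c r.

Definition is_line (A : set R[i]) : Prop :=
  exists a b c : R, (a, b) <> (0, 0) /\
    A = [set z | exists x y : R, z = x +i* y /\ a * x + b * y = c].

End Defs.

Arguments infinity {R}.

(* Main.v *)
Require Import Defs.
From mathcomp Require Import all_boot all_order all_algebra.
From mathcomp Require Import complex ring lra.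
From mathcomp Require Import boolp classical_sets reals topology.
Import Order.TTheory GRing.Theory Num.Theory.
Local Open Scope classical_set_scope.
Local Open Scope ring_scope.
Local Open Scope complex_scope.

(** Substituting [1 / w] for [z] in [|z - z_*|^2 = r^2] and multiplying by
    [|w|^2] gives [d |w|^2 + 2 Re (z_* w) = 1], where [d = r^2 - |z_*|^2].
    When [d <> 0], completing the square turns this into the equation of a
    circle; when [d = 0], which means that [0] lies on the given circle, it is
    the equation of a line. *)

(** Both sides of $|z - c| = r$ are nonnegative, so squaring loses nothing. *)
Lemma circleP (R : realType) (a b r x y : R) : 0 <= r ->
  circle (a +i* b) r (x +i* y) <-> (x - a) ^+ 2 + (y - b) ^+ 2 = r ^+ 2.
Proof.
move=> r0; rewrite /circle /= normc_def /=.
have s0 : 0 <= (x - a) ^+ 2 + (y - b) ^+ 2 by rewrite addr_ge0 ?sqr_ge0.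
split=> [[<-]|->]; first by rewrite sqr_sqrtr.
by rewrite sqrtr_sqr ger0_norm.
Qed.

Lemma sqr_add_gt0 (R : realType) (x y : R) :
  x +i* y != 0 -> 0 < x ^+ 2 + y ^+ 2.
Proof.
move=> xy0; rewrite lt0r addr_ge0 ?sqr_ge0 // andbT.
rewrite paddr_eq0 ?sqr_ge0 // !sqrf_eq0.
by apply: contraNN xy0 => /andP[/eqP-> /eqP->].
Qed.

Lemma circle_invP (R : realType) (a b r x y : R) : 0 <= r -> x +i* y != 0 ->
  circle (a +i* b) r (x +i* y)^-1 <->
  (r ^+ 2 - (a ^+ 2 + b ^+ 2)) * (x ^+ 2 + y ^+ 2) + (a * x - b * y) *+ 2 = 1.
Proof.
move=> r0 /sqr_add_gt0/lt0r_neq0 n0.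
have -> : (x +i* y)^-1 =
    (x / (x ^+ 2 + y ^+ 2)) +i* (- (y / (x ^+ 2 + y ^+ 2))) by [].
rewrite circleP //.
set N := x ^+ 2 + y ^+ 2 in n0 *.
(* The two circle sides differ by the defect of the target equation divided by the nonzero [N], so
   both equations hold together. *)
have -> : (x / N - a) ^+ 2 + (- (y / N) - b) ^+ 2 =
    r ^+ 2 + (1 - ((r ^+ 2 - (a ^+ 2 + b ^+ 2)) * N + (a * x - b * y) *+ 2)) / N.
  by rewrite /N; field.
split=> [/eqP|->]; last by rewrite subrr mul0r addr0.
rewrite -[eqbRHS]addr0 (inj_eq (addrI _)) mulf_eq0 invr_eq0 (negPf n0) orbF.
by rewrite subr_eq0 => /eqP <-.
Qed.

(** Inversion is an involution, so the image is found by testing [w^-1] for nonzero [w]. The point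
    [infinity] arises only from [0], and [0] only from [infinity], which is not a finite point;
    hence [~ D 0]. *)
Lemma inversion_finite_points (R : realType) (S D : set R[i]) :
  ~ D 0 -> (forall w, w != 0 -> S w^-1 <-> D w) ->
  @inversion R @` finite_points S =
  finite_points D `|` [set p | p = infinity /\ S 0].
Proof.
move=> D0 SD; apply/seteqP; split=> [_ [_ [z Sz <-] <-]|p] /=.
  have [z0|z0] := eqVneq z 0; first by right; split=> //; rewrite -z0.
  by left; exists z^-1 => //; apply/SD; rewrite ?invr_eq0 ?invrK.
move=> [[w Dw <-]|[-> S0]].
  have w0 : w != 0 by apply/eqP => w0; apply: D0; rewrite -w0.
  exists (Some w^-1); first by exists w^-1 => //; apply/SD.
  by rewrite /= invr_eq0 (negPf w0) invrK.
by exists (Some 0); [exists 0 | rewrite /= eqxx].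
Qed.

Lemma ReIm_setP (R : realType) (P : R -> R -> Prop) (x y : R) :
  [set z : R[i] | exists x y : R, z = x +i* y /\ P x y] (x +i* y) <-> P x y.
Proof. by split=> [[_ [_ [[<- <-]]]]//|Pxy]; exists x, y. Qed.

Theorem theorem2 (R : realType) (xs ys r : R) (hr : 0 < r) :
  let S := circle (xs +i* ys) r in
  let d := r ^+ 2 - (xs ^+ 2 + ys ^+ 2) in
  let C := [set z : R[i] | exists x y : R, z = x +i* y /\
              (x - (- xs) / d) ^+ 2 + (y - ys / d) ^+ 2 = (r / d) ^+ 2] in
  let L := [set z : R[i] | exists x y : R, z = x +i* y /\
              xs * x - ys * y = 1 / 2] in
  (~ S 0 ->
     is_circle C /\ @inversion R @` finite_points S = finite_points C) /\
  (S 0 ->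
     is_line L /\ @inversion R @` finite_points S = finite_points L `|` [set infinity]).
Proof.
move=> S d C L.
have S0E : S 0 <-> d = 0.
  rewrite -[S 0]/(circle _ _ (0 +i* 0)) circleP ?ltW // !sub0r !sqrrN /d.
  by split=> [->|/subr0_eq->//]; rewrite subrr.
have CP x y : C (x +i* y) <->
    (x - (- xs) / d) ^+ 2 + (y - ys / d) ^+ 2 = (r / d) ^+ 2.
  exact: (ReIm_setP _ (fun x y => _ = _)).
have LP x y : L (x +i* y) <-> xs * x - ys * y = 1 / 2.
  exact: (ReIm_setP _ (fun x y => _ = _)).
split=> [nS0|S0].
  have d0 : d != 0 by apply/eqP => /S0E.
  have CE x y : C (x +i* y) <->
      d * (x ^+ 2 + y ^+ 2) + (xs * x - ys * y) *+ 2 = 1.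
    rewrite CP.
    (* Completing the square, with the remainder kept as a multiple of the defect of the other
       equation. *)
    have -> : (x - (- xs) / d) ^+ 2 + (y - ys / d) ^+ 2 = (r / d) ^+ 2 +
        (d * (x ^+ 2 + y ^+ 2) + (xs * x - ys * y) *+ 2 - 1) / d.
      (* Once [r ^+ 2] is eliminated, the identity holds with [d] as an independent variable. *)
      have -> : (r / d) ^+ 2 = (d + (xs ^+ 2 + ys ^+ 2)) / d ^+ 2.
        by rewrite /d subrK expr_div_n.
      by field.
    split=> [/eqP|->]; last by rewrite subrr mul0r addr0.
    rewrite -[eqbRHS]addr0 (inj_eq (addrI _)) mulf_eq0 invr_eq0 (negPf d0) orbF.
    by rewrite subr_eq0 => /eqP.
  split.
    (* The absolute value is needed: [d] is negative when [0] lies outside the circle. *)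
    exists ((- xs / d) +i* (ys / d)), `|r / d|.
    split; first by rewrite normr_gt0 mulf_neq0 ?invr_eq0 // gt_eqF.
    apply/seteqP; split=> -[x y];
      by rewrite CP circleP ?normr_ge0 // real_normK ?num_real.
  rewrite (inversion_finite_points _ S C).
  - by apply/seteqP; split=> [p [//|[_ /nS0]]//|p]; left.
  (* At the origin the equation reads $0 = 1$. *)
  - move=> /(CE 0 0) /eqP.
    by rewrite !mulr0 subrr expr0n addr0 mulr0 mul0rn addr0 eq_sym oner_eq0.
  - by move=> [x y] w0; rewrite CE /S circle_invP ?ltW.
have d0 : d = 0 by apply/S0E.
split.
  exists xs, (- ys), (1 / 2); split.
    (* A circle centred at [0] would have [d = r ^+ 2], forcing [r = 0]. *)
    case=> xs0 ys0; move: d0 hr; rewrite /d -(sqrrN ys) xs0 ys0 expr0n !addr0 subr0.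
    by move/eqP; rewrite sqrf_eq0 => /eqP->; rewrite ltxx.
  by apply/seteqP; split=> _ [x [y [-> h]]]; exists x, y; rewrite -h mulNr.
rewrite (inversion_finite_points _ S L).
- by congr (_ `|` _); apply/seteqP; split=> p /= => [[]|->].
- by move=> /(LP 0 0); lra.
(* With [d = 0] the quadratic term vanishes and twice the equation of [L] remains. *)
- move=> [x y] w0; rewrite /S circle_invP ?ltW // -/d d0 LP.
  by split; lra.
Qed.
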